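(* Let $s\in(0,1)$, let $\Omega\subset\mathbb{R}^2$ be the Koch snowflake domain and, for $n\in\mathbb{N}$, let $\Omega_n$ be its $n$-th pre-fractal polygonal approximation. Let $f\in L^1(\Omega)$ and let $C_1,C_2>0$ be constants with $C_1+C_2\le1$. Let $\varphi_1,\varphi_2,\varphi_{1,n},\varphi_{2,n}\in W^{s,p}(\Omega)\cap C(\overline\Omega)$ (with $2<sp<p$), with $\varphi_1\le\varphi_2$ and $\varphi_{1,n}\le\varphi_{2,n}$ in $\Omega$ for every $n\in\mathbb{N}$, and set $$\mathcal{K}_\infty=\{v\in W^{s,\infty}(\Omega):\varphi_1\le v\le\varphi_2\text{ in }\Omega,\ \|v\|_{L^\infty(\Omega)}\le C_1,\ |v|_{0,s}\le C_2\},$$ $$\mathcal{K}^n_\infty=\{v\in W^{s,\infty}(\Omega_n):\varphi_{1,n}\le v\le\varphi_{2,n}\text{ in }\Omega_n,\ \|v\|_{L^\infty(\Omega_n)}\le C_1,\ |v|_{0,s,\Omega_n}\le C_2\}.$$ Assume that $\varphi_{1,n},\varphi_{2,n}\in\mathcal{K}^n_\infty$ for every $n\in\mathbb{N}$ and that $$\varphi_{i,n}\to\varphi_i\quad\text{in }C(\overline\Omega)\text{ as }n\to+\infty,\qquad i=1,2.$$ For every $n$, let $u_{\infty,n}\in\mathcal{K}^n_\infty$ be a maximizer of the problem $$\max\left\{\int_{\Omega_n}w(x)f(x)\,dx\,:\,w\in\mathcal{K}^n_\infty\right\},$$ and define, for every $x\in\Omega$, $$\tilde u_{\infty,n}(x)=\sup_{y\in\Omega_n}\left\{u_{\infty,n}(y)-C_2|x-y|^s\right\}.$$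 Then there exists a subsequence of $\tilde u_{\infty,n}$ which, as $n\to+\infty$, $\star$-weakly converges in $W^{s,\infty}(\Omega)$ to a maximizer $\tilde u_\infty$ of the problem $$\max\left\{\int_\Omega w(x)f(x)\,dx\,:\,w\in\mathcal{K}_\infty\right\}.$$
   Context: The Koch snowflake $K\subset\mathbb{R}^2$ is the closed curve which is the union of three coplanar Koch curves built on the sides of an equilateral triangle, and $\Omega$ is the bounded open domain with $\partial\Omega=K$. For $n\in\mathbb{N}$, $K_n$ is the $n$-th pre-fractal closed polygonal curve approximating $K$ (with $3\cdot4^n$ segments), and $\Omega_n$ is the bounded open polygonal domain with $\partial\Omega_n=K_n$; the $\Omega_n$ form an increasing sequence exhausting $\Omega$. $W^{s,p}(\Omega)$, $p<\infty$, is the fractional Sobolev space with norm $\|u\|^p_{W^{s,p}(\Omega)}=\|u\|^p_{L^p(\Omega)}+\iint_{\Omega\times\Omega}\frac{|u(x)-u(y)|^p}{|x-y|^{2+sp}}dx\,dy$. $W^{s,\infty}(\mathcal{G})$ coincides with the Hölder space $C^{0,s}(\mathcal{G})$ ($\mathcal{G}=\Omega$ or $\Omega_n$). $|v|_{0,s}=\sup_{x\ne y\in\Omega}\frac{|v(x)-v(y)|}{|x-y|^s}$ is the seminorm of $C^{0,s}(\Omega)$, and $|v|_{0,s,\Omega_n}$ is the same seminorm with $\Omega$ replaced by $\Omega_n$. The condition $\varphi_{i,n}\in\mathcal{K}^n_\infty$ refers to the restriction of $\varphi_{i,n}$ to $\Omega_n$. *)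

(* Defs.v *)
From HB Require Import structures.
From mathcomp Require Import all_boot all_order all_algebra.
From mathcomp Require Import all_classical all_reals all_analysis.
Import Order.TTheory GRing.Theory Num.Theory numFieldNormedType.Exports.

Set Implicit Arguments.
Unset Strict Implicit.
Unset Printing Implicit Defensive.

Local Open Scope classical_set_scope.
Local Open Scope ring_scope.

(* The plane is R * R: its library topology and measure are the usual ones, but
   its library norm is the max norm, hence a separate Euclidean distance. *)
Definition dist (R : realType) (x y : R * R) : R :=
  Num.sqrt ((x.1 - y.1) ^+ 2 + (x.2 - y.2) ^+ 2).

Section lebesgue_plane.
Context (R : realType).

Definition leb2 := (@lebesgue_measure R \x @lebesgue_measure R)%E.

HB.instance Definition _ := Measure.on leb2.

Let leb2_sigma_finite : sigma_finite setT leb2.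
Proof.
have /sigma_finiteP[F [TF ndF Foo]] := sigma_finiteT (@lebesgue_measure R).
exists (fun n => F n `*` F n).
  rewrite -setXTT TF predeqE => -[x y]; split.
    move=> [/= [n _ Fnx] [k _ Gky]]; exists (maxn n k) => //; split.
    - by move: x Fnx; exact/subsetPset/ndF/leq_maxl.
    - by move: y Gky; exact/subsetPset/ndF/leq_maxr.
  by move=> [n _ []/= ? ?]; split; exists n.
move=> k; have [? ?] := Foo k.
split; first exact: measurableX.
by rewrite /leb2 product_measure1E// lte_mul_pinfty// ge0_fin_numE.
Qed.

(* Without this instance on leb2, leb4 is not inferred to be a measure. *)
HB.instance Definition _ :=
  Measure_isSigmaFinite.Build _ _ _ leb2 leb2_sigma_finite.

Definition leb4 := (leb2 \x leb2)%E.

HB.instance Definition _ := Measure.on leb4.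

End lebesgue_plane.

(* The direct similitude of the plane mapping (0,0) to a and (1,0) to b; it
   sends the upper half-plane to the left of the oriented segment ab. *)
Definition simil (R : realType) (a b : R * R) (z : R * R) : R * R :=
  (a.1 + z.1 * (b.1 - a.1) - z.2 * (b.2 - a.2),
   a.2 + z.1 * (b.2 - a.2) + z.2 * (b.1 - a.1)).

(* The four contractions (ratio 1/3) generating the Koch curve with endpoints
   (0,0) and (1,0), which bulges into the upper half-plane. *)
Definition koch_maps (R : realType) (X : set (R * R)) : set (R * R) :=
  simil (0, 0) (3^-1, 0) @` X
  `|` simil (3^-1, 0) (2^-1, Num.sqrt 3 / 6) @` X
  `|` simil (2^-1, Num.sqrt 3 / 6) (2 / 3, 0) @` X
  `|` simil (2 / 3, 0) (1, 0) @` X.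

Definition koch_prefractal (R : realType) (n : nat) : set (R * R) :=
  iter n (@koch_maps R) [set z | 0 <= z.1 <= 1 /\ z.2 = 0].

(* The Koch curve is the attractor of [koch_maps], i.e., its unique nonempty
   compact invariant set. *)
Definition koch_curve (R : realType) : set (R * R) :=
  xget set0 [set X : set (R * R) | [/\ X !=set0, compact X & koch_maps X = X]].

(* Copies of X along the sides of the equilateral triangle a, b, c with c on
   the right of ab: for a curve X as above, the bumps point outwards. *)
Definition on_triangle (R : realType) (a b : R * R) (X : set (R * R)) :
    set (R * R) :=
  let c := simil a b (2^-1, - (Num.sqrt 3 / 2)) in
  simil a b @` X `|` simil b c @` X `|` simil c a @` X.

Definition koch_snowflake (R : realType) (a b : R * R) : set (R * R) :=
  on_triangle a b (@koch_curve R).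

Definition koch_polygon (R : realType) (a b : R * R) (n : nat) : set (R * R) :=
  on_triangle a b (@koch_prefractal R n).

Definition bounded_domain_with_boundary (R : realType)
    (C G : set (R * R)) : Prop :=
  [/\ open G, connected G, bounded_set G & closure G `\` interior G = C].

(* The p-th power of the norm of W^{s,p}(G). *)
Definition sobolev_normp (R : realType) (s p : R) (G : set (R * R))
    (u : R * R -> R) : \bar R :=
  (\int[@leb2 R]_(x in G) (`|u x| `^ p)%:E +
   \int[@leb4 R]_(z in G `*` G)
     (`|u z.1 - u z.2| `^ p / dist z.1 z.2 `^ (2 + s * p))%:E)%E.

Definition sobolev (R : realType) (s p : R) (G : set (R * R)) :
    set (R * R -> R) :=
  [set u | measurable_fun G u /\ (sobolev_normp s p G u < +oo)%E].

Definition continuous_on_closure (R : realType) (G : set (R * R)) :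
    set (R * R -> R) :=
  [set u | {within closure G, continuous u}].

Definition hoelder_quotient (R : realType) (s : R) (u : R * R -> R)
    (z : (R * R) * (R * R)) : R :=
  (u z.1 - u z.2) / dist z.1 z.2 `^ s.

Definition hoelder_seminorm (R : realType) (s : R) (G : set (R * R))
    (u : R * R -> R) : \bar R :=
  ereal_sup [set `|hoelder_quotient s u z|%:E |
              z in [set z | [/\ G z.1, G z.2 & z.1 != z.2]]].

Definition Linfty_norm (R : realType) (G : set (R * R)) (u : R * R -> R) :
    \bar R :=
  'N[@leb2 R]_+oo [EFin \o (u \_ G)]%E.

(* W^{s,oo}(G) = C^{0,s}(G); elements are represented by functions on the whole
   plane, of which only the values on G matter. *)
Definition sobolev_infty (R : realType) (s : R) (G : set (R * R)) :
    set (R * R -> R) :=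
  [set u | (ereal_sup [set `|u x|%:E | x in G] < +oo)%E
           /\ (hoelder_seminorm s G u < +oo)%E].

Definition obstacle_set (R : realType) (s C1 C2 : R) (G : set (R * R))
    (phi1 phi2 : R * R -> R) : set (R * R -> R) :=
  [set v | [/\ sobolev_infty s G v,
               forall x, G x -> phi1 x <= v x <= phi2 x,
               (Linfty_norm G v <= C1%:E)%E &
               (hoelder_seminorm s G v <= C2%:E)%E]].

Definition maximizer (R : realType) (G : set (R * R)) (f : R * R -> R)
    (A : set (R * R -> R)) (u : R * R -> R) : Prop :=
  A u /\ forall w, A w ->
    \int[@leb2 R]_(x in G) (w x * f x) <= \int[@leb2 R]_(x in G) (u x * f x).

Definition mcshane (R : realType) (s C2 : R) (G : set (R * R))
    (u : R * R -> R) (x : R * R) : R :=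
  sup [set u y - C2 * dist x y `^ s | y in G].

(* The weak-star topology of W^{s,oo}(G) is the one induced by the embedding
   u |-> (u, hoelder_quotient s u) into L^oo(G) x L^oo(G x G), a weak-star
   closed subspace of the dual of L^1(G) x L^1(G x G). *)
Definition weakstar_cvg (R : realType) (s : R) (G : set (R * R))
    (u_ : nat -> R * R -> R) (u : R * R -> R) : Prop :=
  [/\ forall n, sobolev_infty s G (u_ n),
      sobolev_infty s G u,
      forall g : R * R -> R, (@leb2 R).-integrable G (EFin \o g) ->
        \int[@leb2 R]_(x in G) (u_ n x * g x) @[n --> \oo]
          --> \int[@leb2 R]_(x in G) (u x * g x) &
      forall h : (R * R) * (R * R) -> R,
        (@leb4 R).-integrable (G `*` G) (EFin \o h) ->
        \int[@leb4 R]_(z in G `*` G) (hoelder_quotient s (u_ n) z * h z)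
            @[n --> \oo]
          --> \int[@leb4 R]_(z in G `*` G) (hoelder_quotient s u z * h z)].

(* Main.v *)
Require Import Defs.
From HB Require Import structures.
From mathcomp Require Import all_boot all_order all_algebra.
From mathcomp Require Import all_classical all_reals all_analysis.
From mathcomp Require Import measurable_realfun ess_sup_inf lra.
Import Order.TTheory GRing.Theory Num.Theory numFieldNormedType.Exports.
Local Open Scope classical_set_scope.
Local Open Scope ring_scope.

(** Why the theorem holds. Each [u_ n] is Hoelder on [Omega_ n] with constant
    [C2], and [dist x y `^ s] is again a distance since [s <= 1], so the McShane
    extension of [u_ n] agrees with [u_ n] on [Omega_ n] and is Hoelder on the
    whole plane with the same constant ([mcshane_id], [mcshane_hoelder]). The
    extensions are equi-Hoelder and pointwise bounded, so by an Arzela-Ascoli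
    argument some subsequence converges pointwise to a Hoelder function [u]
    ([hoelder_selection]). Pointwise convergence is enough for everything else:

    - The functions and their Hoelder quotients are uniformly bounded, on the
      bounded set [Omega] and on [Omega `*` Omega]. Dominated convergence
      against [L^1] functions therefore gives weak-star convergence.

    - Every [x] in [Omega] lies in [Omega_ n] for all large [n], where the
      extension is [u_ n x]. The bounds defining the obstacle sets pass to the
      limit, so [u] is admissible.

    - For the maximality of [u], a competitor [v] in the limit obstacle set is
      approximated by admissible competitors at level [n], namely [v] clamped
      between [phi1_ n] and [phi2_ n]. Clamping keeps the Hoelder constant and
      the sup bound because the two obstacles satisfy them
      ([clamp_obstacle_set]), and the clamped functions converge to [v] because
      the obstacles converge ([cvg_clamp]). Passing to the limit in the
      inequality of the integrals over [Omega_ n] uses dominated convergence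
      along an exhaustion ([cvg_Rintegral_exhaustion]).

    The conditions defining the obstacle sets are an essential supremum and a
    supremum of quotients; on an open set both amount to pointwise inequalities
    ([obstacle_setP]), which is the form used throughout. *)

(** * The Euclidean distance and its powers *)

Section euclidean_plane.
Context {R : realType}.
Implicit Types (x y z : R * R) (s c e : R).

Lemma dist_ge0 x y : 0 <= dist x y.
Proof. exact: sqrtr_ge0. Qed.

Lemma dist_sym x y : dist x y = dist y x.
Proof. by rewrite /dist -(sqrrN (x.1 - _)) -(sqrrN (x.2 - _)) !opprB. Qed.

Lemma distxx x : dist x x = 0.
Proof. by rewrite /dist !subrr expr0n addr0 sqrtr0. Qed.

Lemma dist_gt0 x y : x != y -> 0 < dist x y.
Proof.
move=> xy; rewrite sqrtr_gt0 lt_neqAle addr_ge0 ?sqr_ge0// andbT eq_sym.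
apply: contra xy; rewrite paddr_eq0 ?sqr_ge0// !sqrf_eq0 !subr_eq0.
by move: x y => [x1 x2] [y1 y2] /= /andP[/eqP-> /eqP->].
Qed.

Lemma dist_triangle y x z : dist x z <= dist x y + dist y z.
Proof.
rewrite -ler_sqr ?nnegrE ?addr_ge0 ?dist_ge0// sqrrD.
rewrite /dist !sqr_sqrtr ?addr_ge0 ?sqr_ge0//.
set p := x.1 - y.1; set q := x.2 - y.2.
set p' := y.1 - z.1; set q' := y.2 - z.2.
have -> : x.1 - z.1 = p + p' by rewrite /p /p' subrKA.
have -> : x.2 - z.2 = q + q' by rewrite /q /q' subrKA.
(* Cauchy-Schwarz in the plane, via Lagrange's identity *)
have CS : p * p' + q * q' <=
    Num.sqrt (p ^+ 2 + q ^+ 2) * Num.sqrt (p' ^+ 2 + q' ^+ 2).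
  rewrite -sqrtrM ?addr_ge0 ?sqr_ge0//.
  apply: le_trans (ler_norm _) _; rewrite -sqrtr_sqr ler_wsqrtr//.
  have := sqr_ge0 (p * q' - q * p'); nra.
by rewrite -mulr_natr; nra.
Qed.

Lemma dist_le_normD x y : dist x y <= `|x.1 - y.1| + `|x.2 - y.2|.
Proof.
rewrite -ler_sqr ?nnegrE ?addr_ge0 ?dist_ge0// sqrrD !real_normK ?num_real//.
by rewrite sqr_sqrtr ?addr_ge0 ?sqr_ge0// addrAC lerDl mulrn_wge0 ?mulr_ge0.
Qed.

Lemma dist_lt_ball x y e : ball x e y -> dist x y < e + e.
Proof.
move=> [xy1 xy2]; apply: le_lt_trans (dist_le_normD x y) _.
by rewrite ltrD.
Qed.

(** Concavity of the power, in the form [t <= t `^ s] when [0 < t <= 1], applied to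
    the two proportions [c / (c + e)] and [e / (c + e)], which sum to 1. *)
Lemma powR_subadditive s c e : 0 < s -> s <= 1 -> 0 <= c -> 0 <= e ->
  (c + e) `^ s <= c `^ s + e `^ s.
Proof.
move=> s0 s1; rewrite le_eqVlt => /predU1P[<- _|c0].
  by rewrite !add0r lerDr powR_ge0.
rewrite le_eqVlt => /predU1P[<-|e0]; first by rewrite !addr0 lerDl powR_ge0.
have ce0 : 0 < c + e by rewrite addr_gt0.
have frac t : 0 < t -> t <= c + e -> t / (c + e) * (c + e) `^ s <= t `^ s.
  move=> t0 tce.
  have -> : t `^ s = (t / (c + e)) `^ s * (c + e) `^ s.
    by rewrite -powRM ?divr_ge0 ?divfK// ?gt_eqF// ltW.
  rewrite ler_wpM2r ?powR_ge0// ger1_powR//.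
  by rewrite divr_gt0//= ler_pdivrMr// mul1r.
rewrite -[leLHS]mul1r -[X in X * _](@divff _ (c + e)) ?gt_eqF// [X in X * _]mulrDl.
by rewrite mulrDl lerD// frac// ?lerDl ?lerDr ltW.
Qed.

Lemma dist_powR_triangle s y x z : 0 < s -> s <= 1 ->
  dist x z `^ s <= dist x y `^ s + dist y z `^ s.
Proof.
move=> s0 s1; apply: le_trans (powR_subadditive _ _ _ s0 s1 _ _) => //;
  rewrite ?dist_ge0//.
by apply: ge0_ler_powR; rewrite ?nnegrE ?addr_ge0 ?dist_ge0 ?dist_triangle// ltW.
Qed.

End euclidean_plane.

(** * Hoelder functions *)

Section hoelder.
Context {R : realType} (s : R) (s0 : 0 < s).
Implicit Types (x y z : R * R) (C : R) (G : set (R * R)) (u v : R * R -> R).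

Definition hoelder_on C G u :=
  forall x y, G x -> G y -> `|u x - u y| <= C * dist x y `^ s.

Lemma hoelder_onS C G H u : G `<=` H -> hoelder_on C H u -> hoelder_on C G u.
Proof. by move=> GH hu x y /GH Hx /GH; exact: hu. Qed.

Lemma hoelder_on_max C G u v : hoelder_on C G u -> hoelder_on C G v ->
  hoelder_on C G (fun x => Num.max (u x) (v x)).
Proof.
move=> hu hv x y Gx Gy; have := hu _ _ Gx Gy; have := hv _ _ Gx Gy.
set D := C * _; rewrite !ler_norml.
have [?|?] := leP (u x) (v x); have [?|?] := leP (u y) (v y) => *; lra.
Qed.

Lemma hoelder_on_min C G u v : hoelder_on C G u -> hoelder_on C G v ->
  hoelder_on C G (fun x => Num.min (u x) (v x)).
Proof.
move=> hu hv x y Gx Gy; have := hu _ _ Gx Gy; have := hv _ _ Gx Gy.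
set D := C * _; rewrite !ler_norml.
have [?|?] := leP (u x) (v x); have [?|?] := leP (u y) (v y) => *; lra.
Qed.

(** A modulus of continuity common to all functions with Hoelder constant [C]:
    equicontinuity is what the selection argument needs. *)
Lemma hoelder_modulus C e : 0 <= C -> 0 < e ->
  exists2 d, 0 < d & forall x y, dist x y < d -> C * dist x y `^ s < e.
Proof.
move=> C0 e0; have C1 : 0 < C + 1 by rewrite ltr_wpDl.
(* [C + 1] instead of [C] because [C] may vanish *)
exists ((e / (C + 1)) `^ s^-1); first by apply: powR_gt0; exact: divr_gt0.
move=> x y xy.
have ds : dist x y `^ s < e / (C + 1).
  have -> : e / (C + 1) = ((e / (C + 1)) `^ s^-1) `^ s.
    by rewrite -powRrM mulVf ?gt_eqF// powRr1// divr_ge0 ?ltW.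
  by apply: gt0_ltr_powR; rewrite ?nnegrE ?dist_ge0 ?powR_ge0.
apply: le_lt_trans (_ : (C + 1) * dist x y `^ s < e).
  by rewrite ler_wpM2r ?powR_ge0// lerDl.
by rewrite mulrC -ltr_pdivlMr.
Qed.

Lemma hoelder_on_continuous C G u x : 0 <= C -> hoelder_on C G u ->
  nbhs x G -> {for x, continuous u}.
Proof.
move=> C0 hu Gx; apply/cvgrPdist_lt => e e0.
have [d d0 ud] := hoelder_modulus _ _ C0 e0.
near=> y; apply: le_lt_trans (hu _ _ _ _) (ud _ _ _).
- exact: nbhs_singleton.
- by near: y.
- rewrite (splitr d); apply: dist_lt_ball; near: y.
  have d20 : 0 < d / 2 by rewrite divr_gt0.
  exact: (nbhsx_ballx x (d / 2) d20).
Unshelve. all: by end_near. Qed.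

End hoelder.

(** * The McShane extension *)

Section mcshane_extension.
Context {R : realType} (s : R) (s0 : 0 < s) (s1 : s <= 1).
Implicit Types (x y z : R * R) (C : R) (G : set (R * R)) (u v : R * R -> R).

(** The next two estimates hold because the triangle inequality for [dist `^ s]
    makes [u y + C * dist x y `^ s] an upper bound of the set whose supremum is
    the extension. *)
Lemma mcshane_ge C G u x y : 0 <= C -> hoelder_on s C G u -> G y ->
  u y - C * dist x y `^ s <= mcshane s C G u x.
Proof.
move=> C0 hu Gy; apply: ub_le_sup; last by exists y.
exists (u y + C * dist x y `^ s) => _ [z Gz <-].
have := hu _ _ Gz Gy; rewrite ler_norml => /andP[_].
have := ler_wpM2l C0 (dist_powR_triangle s x z y s0 s1).
rewrite mulrDr (dist_sym z x).
move: (C * _) (C * _) (C * _) (u y) (u z) => p q r a b; lra.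
Qed.

Lemma mcshane_le C G u x y : 0 <= C -> hoelder_on s C G u -> G y ->
  mcshane s C G u x <= u y + C * dist x y `^ s.
Proof.
move=> C0 hu Gy; apply: ge_sup; first by exists (u y - C * dist x y `^ s), y.
move=> _ [z Gz <-].
have := hu _ _ Gz Gy; rewrite ler_norml => /andP[_].
have := ler_wpM2l C0 (dist_powR_triangle s x z y s0 s1).
rewrite mulrDr (dist_sym z x).
move: (C * _) (C * _) (C * _) (u y) (u z) => p q r a b; lra.
Qed.

Lemma mcshane_id C G u x : 0 <= C -> hoelder_on s C G u -> G x ->
  mcshane s C G u x = u x.
Proof.
move=> C0 hu Gx; have := mcshane_ge C G u x x C0 hu Gx.
have := mcshane_le C G u x x C0 hu Gx.
rewrite distxx powR0 ?gt_eqF// mulr0 subr0 addr0 => ? ?.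
by apply/eqP; rewrite eq_le; apply/andP.
Qed.

Lemma mcshane_hoelder C G u : 0 <= C -> hoelder_on s C G u ->
  hoelder_on s C setT (mcshane s C G u).
Proof.
move=> C0 hu.
have [->|/set0P[y0 Gy0]] := eqVneq G set0.
  (* the supremum of the empty set is 0, hence the extension is constant *)
  move=> x y _ _; rewrite /mcshane !image_set0 subrr normr0.
  by rewrite mulr_ge0 ?powR_ge0.
have one_sided x y :
    mcshane s C G u x <= mcshane s C G u y + C * dist x y `^ s.
  apply: ge_sup; first by exists (u y0 - C * dist x y0 `^ s), y0.
  move=> _ [z Gz <-]; have := mcshane_ge C G u y z C0 hu Gz.
  have := ler_wpM2l C0 (dist_powR_triangle s x y z s0 s1).
  rewrite mulrDr (dist_sym y x).
  move: (C * _) (C * _) (C * _) (u z) (mcshane _ _ _ _ _) => p q r a b; lra.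
move=> x y _ _; rewrite ler_distl lerBlDr.
by apply/andP; split; [rewrite (dist_sym x y)|]; exact: one_sided.
Qed.

Lemma mcshane_bounded C M e G u x : 0 <= C -> 0 <= M -> 0 <= e ->
  hoelder_on s C G u -> (forall y, G y -> `|u y| <= M) ->
  (forall y, G y -> dist x y <= e) -> `|mcshane s C G u x| <= M + C * e `^ s.
Proof.
move=> C0 M0 e0 hu uM xe.
have [->|/set0P[y Gy]] := eqVneq G set0.
  by rewrite /mcshane image_set0 sup0 normr0 addr_ge0 ?mulr_ge0 ?powR_ge0.
have Cd : C * dist x y `^ s <= C * e `^ s.
  rewrite ler_wpM2l// ge0_ler_powR ?nnegrE ?dist_ge0 ?xe//; exact: ltW.
have := uM _ Gy; have := mcshane_ge C G u x y C0 hu Gy.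
have := mcshane_le C G u x y C0 hu Gy; move: Cd; rewrite !ler_norml.
move: (C * _) (C * _) (mcshane _ _ _ _ _) (u y) => *; lra.
Qed.

End mcshane_extension.

(** * Measurability and null sets in the plane *)

Section plane_measure.
Context {R : realType}.
Implicit Types (x y : R * R) (U G : set (R * R)).

(** An open set is the countable union of the squares with rational centre and
    size that it contains, and squares are products of intervals. *)
Lemma open_measurable_plane U : open U -> measurable U.
Proof.
move=> oU.
pose B (q : rat * rat * rat) : set (R * R) :=
  ball (ratr q.1.1 : R) (ratr q.2) `*` ball (ratr q.1.2 : R) (ratr q.2).
have -> : U = \bigcup_q (if `[< B q `<=` U >] then B q else set0).
  apply/seteqP; split=> [x Ux|x [q _]]; last by case: asboolP => [BU /BU|].
  have /nbhs_ballP[e /= e0 xeU] := open_nbhs_nbhs (conj oU Ux).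
  (* a radius below [e / 2] keeps the whole square around the nearby rational
     centre inside the ball of radius [e] *)
  have [r] := rat_in_itvoo (divr_gt0 e0 (@ltr0n R 2)).
  rewrite in_itv/= => /andP[r0 re].
  have near_rat (t : R) : exists q : rat, `|ratr q - t| < ratr r.
    have tr : t - ratr r < t + ratr r by rewrite ltrBlDr -addrA ltrDl addr_gt0.
    have [q] := rat_in_itvoo tr.
    by rewrite in_itv/= => /andP[? ?]; exists q; rewrite ltr_norml; lra.
  have [q1 xq1] := near_rat x.1; have [q2 xq2] := near_rat x.2.
  exists (q1, q2, r) => //=; case: asboolP => [_|[]]; first by split.
  move=> y [/= y1 y2]; apply: xeU; split=> /=.
    move: xq1 y1; rewrite /ball/= => xq1 y1.
    rewrite distrC in xq1; have := ler_distD (ratr q1) x.1 y.1; lra.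
  move: xq2 y2; rewrite /ball/= => xq2 y2.
  rewrite distrC in xq2; have := ler_distD (ratr q2) x.2 y.2; lra.
apply: countable_bigcupT_measurable; first exact: countableP.
move=> q; case: ifP => // _; apply: measurableX; exact: measurable_ball.
Qed.

Lemma hoelder_measurable s C (u : R * R -> R) : 0 < s -> 0 <= C ->
  hoelder_on s C setT u -> measurable_fun setT u.
Proof.
move=> s0 C0 hu.
have cu : continuous u.
  by move=> x; apply: (hoelder_on_continuous s s0 C setT) => //; exact: filterT.
apply: (measurability _ (RGenOInfty.measurableE R)).
move=> _ [_ [t ->] <-]; rewrite setTI; apply: open_measurable_plane.
by move/continuousP: cu; apply; exact: interval_open.
Qed.

Lemma measurable_dist :
  measurable_fun setT (fun z : (R * R) * (R * R) => dist z.1 z.2).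
Proof.
have m1 : measurable_fun setT
    (fun z : (R * R) * (R * R) => (z.1.1 - z.2.1) ^+ 2 + (z.1.2 - z.2.2) ^+ 2).
  have mf := @measurable_fst _ _ R R; have ms := @measurable_snd _ _ R R.
  have Mf := @measurable_fst _ _ (R * R)%type (R * R)%type.
  have Ms := @measurable_snd _ _ (R * R)%type (R * R)%type.
  apply: measurable_funD; apply: measurable_funX; apply: measurable_funB.
  - exact: (measurableT_comp mf Mf).
  - exact: (measurableT_comp mf Ms).
  - exact: (measurableT_comp ms Mf).
  - exact: (measurableT_comp ms Ms).
have := measurableT_comp (@measurable_powR R 2^-1) m1.
apply: eq_measurable_fun => z _ /=.
by rewrite powR12_sqrt// addr_ge0 ?sqr_ge0.
Qed.

Lemma measurable_hoelder_quotient s (u : R * R -> R) :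
  measurable_fun setT u -> measurable_fun setT (hoelder_quotient s u).
Proof.
move=> mu.
have Mf := @measurable_fst _ _ (R * R)%type (R * R)%type.
have Ms := @measurable_snd _ _ (R * R)%type (R * R)%type.
(* a quotient by a power becomes a product with the opposite power, also where
   the distance vanishes, so that only measurability of powers is used *)
rewrite (_ : hoelder_quotient s u = fun z =>
    (u z.1 - u z.2) * dist z.1 z.2 `^ (- s)); last first.
  by apply/funext => z; rewrite powRN.
apply: measurable_funM.
  apply: measurable_funB; first exact: (measurableT_comp mu Mf).
  exact: (measurableT_comp mu Ms).
exact: (measurableT_comp (@measurable_powR R (- s)) measurable_dist).
Qed.

Lemma nbhs_not_negligible U x : nbhs x U -> ~ (@leb2 R).-negligible U.
Proof.
move=> /nbhs_ballP[e /= e0 eU] [N [mN N0 UN]].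
pose B : set (R * R) := ball x.1 e `*` ball x.2 e.
have mB : measurable B by apply: measurableX; exact: measurable_ball.
have BN : B `<=` N by move=> y By; apply: UN; apply: eU; case: By.
have : (@leb2 R B <= 0)%E by rewrite -N0; apply: le_measure; rewrite ?inE.
rewrite /leb2 product_measure1E; [|exact: measurable_ball..].
have bE (t : R) : lebesgue_measure (ball t e) = (e *+ 2)%:E.
  exact/lebesgue_measure_ball/ltW.
have e20 : 0 < e *+ 2 by rewrite mulrn_wgt0.
rewrite [X in (X * _)%E]bE [X in (_ * X)%E]bE -EFinM lee_fin leNgt.
by rewrite mulr_gt0.
Qed.

End plane_measure.

(** * Pointwise description of the obstacle sets *)

Section obstacle_set.
Context {R : realType} (s : R) (s0 : 0 < s).
Implicit Types (x y : R * R) (C : R) (G : set (R * R)) (u v : R * R -> R).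

Lemma hoelder_quotient_le C u x y : x != y ->
  (`|hoelder_quotient s u (x, y)| <= C) = (`|u x - u y| <= C * dist x y `^ s).
Proof.
move=> xy; have d0 : 0 < dist x y `^ s by apply: powR_gt0; exact: dist_gt0.
by rewrite /hoelder_quotient/= normrM normfV (gtr0_norm d0) ler_pdivrMr.
Qed.

Lemma hoelder_quotient_bounded C G u z : 0 <= C -> hoelder_on s C G u ->
  (G `*` G) z -> `|hoelder_quotient s u z| <= C.
Proof.
move=> C0 hu; case: z => x y [/= Gx Gy]; have [->|xy] := eqVneq x y.
  by rewrite /hoelder_quotient subrr mul0r normr0.
by rewrite hoelder_quotient_le//; exact: hu.
Qed.

Lemma hoelder_seminormP C G u : 0 <= C ->
  (hoelder_seminorm s G u <= C%:E)%E <-> hoelder_on s C G u.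
Proof.
move=> C0; split=> [uC x y Gx Gy|hu].
  have [->|xy] := eqVneq x y.
    by rewrite subrr normr0 mulr_ge0 ?powR_ge0.
  rewrite -hoelder_quotient_le// -lee_fin; apply: le_trans uC; apply: ereal_sup_ubound.
  by exists (x, y).
apply: ge_ereal_sup => _ [[x y] [/= Gx Gy xy] <-].
by rewrite lee_fin; exact: hoelder_quotient_bounded hu _.
Qed.

(** An essential bound of a continuous function on an open set is a bound: a
    point of violation has a neighbourhood of violation, which is not null. *)
Lemma Linfty_normP C M G u : open G -> 0 <= C -> 0 <= M -> hoelder_on s C G u ->
  (Linfty_norm G u <= M%:E)%E <-> (forall x, G x -> `|u x| <= M).
Proof.
move=> oG C0 M0 hu.
have leb2T : (0 < @leb2 R setT)%E.
  rewrite lt0e measure_ge0 andbT; apply/eqP => T0.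
  by apply: (@nbhs_not_negligible R setT (0, 0)); [exact: filterT|exists setT].
rewrite /Linfty_norm unlock leb2T; split=> [/ess_supP uM x Gx|uM].
  rewrite leNgt; apply/negP => Mu.
  apply: (@nbhs_not_negligible R (G `&` [set y | M < `|u y|]) x).
    have xG : nbhs x G by apply: open_nbhs_nbhs.
    apply: filterI => //.
    have cu : `|u y| @[y --> x] --> `|u x|.
      by apply: cvg_norm; exact: (hoelder_on_continuous s s0 C G).
    exact: (cvgr_gt _ cu).
  apply: negligibleS uM => y [Gy /= My]; rewrite /= patchE mem_set//= lee_fin.
  by apply/negP; rewrite -ltNge.
apply/ess_supP; apply: nearW => x /=; rewrite lee_fin patchE.
by case: ifPn => [/set_mem /uM //|_]; rewrite normr0.
Qed.

Lemma sobolev_inftyP M C G u : 0 <= C -> (forall x, G x -> `|u x| <= M) ->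
  hoelder_on s C G u -> sobolev_infty s G u.
Proof.
move=> C0 uM /(hoelder_seminormP _ _ _ C0) uC; split.
  apply: le_lt_trans (ltry M); apply: ge_ereal_sup => _ [x Gx <-].
  by rewrite lee_fin; exact: uM.
exact: le_lt_trans uC (ltry C).
Qed.

Lemma obstacle_setP C1 C2 G phi1 phi2 v : open G -> 0 <= C1 -> 0 <= C2 ->
  obstacle_set s C1 C2 G phi1 phi2 v <->
  [/\ hoelder_on s C2 G v, forall x, G x -> `|v x| <= C1 &
      forall x, G x -> phi1 x <= v x <= phi2 x].
Proof.
move=> oG C10 C20; split.
  move=> [_ vphi v1 /(hoelder_seminormP _ _ _ C20) hv]; split => //.
  exact/(Linfty_normP _ _ _ _ oG C20 C10 hv).
move=> [hv v1 vphi]; split=> //.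
- exact: (sobolev_inftyP C1 C2).
- exact/(Linfty_normP _ _ _ _ oG C20 C10 hv).
- exact/hoelder_seminormP.
Qed.

End obstacle_set.

(** * Dominated convergence along an exhaustion *)

Section exhaustion.
Context d (T : measurableType d) (R : realType) (mu : {measure set T -> \bar R}).

(** Dominated convergence for the functions [v_ n * g] extended by 0 outside
    [D_ n], with dominating function [`|M| * `|g|]. *)
Lemma cvg_Rintegral_exhaustion (D : set T) (D_ : nat -> set T)
    (v_ : nat -> T -> R) (v g : T -> R) (M : R) :
  measurable D -> (forall n, measurable (D_ n)) -> (forall n, D_ n `<=` D) ->
  (forall x, D x -> \forall n \near \oo, D_ n x) ->
  (forall n, measurable_fun D (v_ n)) ->
  (forall n x, D_ n x -> `|v_ n x| <= M) ->
  (forall x, D x -> v_ n x @[n --> \oo] --> v x) ->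
  mu.-integrable D (EFin \o g) ->
  \int[mu]_(x in D_ n) (v_ n x * g x) @[n --> \oo]
    --> \int[mu]_(x in D) (v x * g x).
Proof.
move=> mD mD_ DD_ exh mv_ v_M v_v ig.
have mg : measurable_fun D g by apply/measurable_EFinP; case/integrableP: ig.
have mv : measurable_fun D v by exact: measurable_fun_cvg v_v.
pose f_ n : T -> \bar R := EFin \o ((fun x => v_ n x * g x) \_ (D_ n)).
pose f : T -> \bar R := EFin \o (fun x => v x * g x).
pose h : T -> \bar R := fun x => (`|M|%:E * `|(EFin \o g) x|)%E.
have mf_ n : measurable_fun D (f_ n).
  apply/measurable_EFinP/measurable_restrict => //.
  apply: measurable_funS (measurable_funM (mv_ n) mg) => //.
have mf : measurable_fun D f.
  by apply/measurable_EFinP; exact: measurable_funM.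
have f_f x : D x -> f_ n x @[n --> \oo] --> f x.
  move=> Dx; apply/fine_cvgP; split; first exact: nearW.
  have vg : v_ n x * g x @[n --> \oo] --> v x * g x.
    by apply: cvgM; [exact: v_v|exact: cvg_cst].
  apply: cvg_trans vg; apply: near_eq_cvg; near=> n.
  by rewrite /= patchE mem_set//; near: n; exact: exh.
have ih : mu.-integrable D h by apply: integrableZl => //; exact: integrable_abse.
have f_h n x : D x -> (`|f_ n x| <= h x)%E.
  move=> Dx; rewrite /f_ /h/= lee_fin patchE; case: ifPn => [/set_mem D_x|_].
    rewrite normrM ler_wpM2r//; apply: le_trans (v_M _ _ D_x) _; exact: ler_norm.
  by rewrite normr0 mulr_ge0.
have [int_f _ cvg_f] := dominated_convergence mD mf_ mf
  (aeW _ f_f) ih (aeW _ (fun x n => @f_h n x)).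
have -> : (fun n => \int[mu]_(x in D_ n) (v_ n x * g x)) =
    fine \o (fun n => \int[mu]_(x in D) f_ n x)%E.
  apply/funext => n /=.
  have /setIidPr <- := DD_ n; rewrite Rintegral_mkcondr.
  by rewrite /Rintegral.
apply: fine_cvg; rewrite fineK//.
exact: integrable_fin_num.
Unshelve. all: by end_near. Qed.

End exhaustion.

(** * Selection of a pointwise convergent subsequence *)

Section selection.
Context {R : realType} (s : R) (s0 : 0 < s).

(** By Tychonoff's theorem a pointwise bounded sequence has a cluster point for
    the topology of pointwise convergence. This topology is not metrizable in
    general, so the cluster point is only approached on finitely many points at
    a time. *)
Lemma cluster_ptws (T : choiceType) (w : nat -> T -> R) (B : T -> R) :
  (forall n x, `|w n x| <= B x) ->
  exists u : T -> R, forall (l : seq T) (e : R) (N : nat), 0 < e ->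
    exists2 m, (N <= m)%N & {in l, forall x, `|w m x - u x| < e}.
Proof.
move=> wB.
have cB : @compact {ptws T -> R} [set f | forall x, `[- B x, B x]%classic (f x)].
  apply: (@tychonoff T (fun=> R : topologicalType)
    (fun x => `[- B x, B x]%classic)) => x.
  exact: segment_compact.
have wF : ((w : nat -> {ptws T -> R}) n @[n --> \oo])
    [set f | forall x, `[- B x, B x]%classic (f x)].
  by exists 0%N => // n _ x /=; rewrite in_itv/= -ler_norml.
have [u [_ clu]] := cB _ _ wF; exists u => l e N e0.
have near_ux x : nbhs (u : {ptws T -> R}) [set h | `|h x - u x| < e].
  have nux : nbhs (u x) [set t : R | `|t - u x| < e].
    by apply/nbhs_ballP; exists e => // t; rewrite /ball/= distrC.
  exact: (@proj_continuous T (fun=> R : topologicalType) x u _ nux).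
have near_u : nbhs (u : {ptws T -> R}) [set h | {in l, forall x, `|h x - u x| < e}].
  have : Filter (nbhs (u : {ptws T -> R})) by exact: nbhs_filter.
  move: (nbhs _) near_ux => F near_ux FF.
  elim: l => [|x l IHl]; first by apply: filterE => h x; rewrite in_nil.
  apply: filterS (filterI (near_ux x) IHl) => h [hx hl] y.
  by rewrite inE => /predU1P[->//|]; exact: hl.
have tail : ((w : nat -> {ptws T -> R}) n @[n --> \oo])
    [set h | exists2 m, (N <= m)%N & h = w m].
  by exists N => // m /= Nm; exists m.
by have [_ [[m Nm ->] wm]] := clu _ _ tail near_u; exists m.
Qed.

(** The [j]-th term of the subsequence is chosen [1 / (j + 1)]-close to a
    pointwise cluster point [u] on the first [j] points of an enumeration of the
    rational points. The subsequence thus converges to [u] at the rational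
    points, and equicontinuity extends the convergence to the whole plane. *)
Lemma hoelder_selection C (w : nat -> R * R -> R) (B : R * R -> R) : 0 <= C ->
  (forall n, hoelder_on s C setT (w n)) -> (forall n x, `|w n x| <= B x) ->
  exists (k : nat -> nat) (u : R * R -> R),
    [/\ {homo k : m n / (m < n)%N}, hoelder_on s C setT u &
        forall x, w (k j) x @[j --> \oo] --> u x].
Proof.
move=> C0 hw wB; have [u uP] := cluster_ptws _ _ _ wB.
have hu : hoelder_on s C setT u.
  move=> x y _ _; apply/ler_addgt0Pr => e e0.
  have [m _ um] := uP [:: x; y] (e / 2) 0%N (divr_gt0 e0 (@ltr0n R 2)).
  have ux := um x (mem_head _ _).
  have uy : `|w m y - u y| < e / 2 by apply: um; rewrite !inE eqxx orbT.
  have wxy := hw m x y I I.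
  move: (C * _) wxy => K; move: ux uy; rewrite !ltr_norml !ler_norml.
  by move: (w m x) (w m y) (u x) (u y) => *; lra.
(* [l j] lists the rational points whose code is less than [j] *)
pose q (r : rat * rat) : R * R := (ratr r.1, ratr r.2).
pose l j : seq (R * R) := [seq q r | r <- pmap unpickle (iota 0 j)].
have [sel selP] : exists sel : nat -> nat -> nat, forall j N,
    (N <= sel j N)%N /\
    {in l j, forall x, `|w (sel j N) x - u x| < j.+1%:R^-1}.
  have /choice : forall jN : nat * nat, exists m, (jN.2 <= m)%N /\
      {in l jN.1, forall x, `|w m x - u x| < jN.1.+1%:R^-1}.
    move=> [j N]; have [|m Nm um] := uP (l j) j.+1%:R^-1 N; last by exists m.
    by rewrite invr_gt0.
  move=> [sel selP]; exists (fun j N => sel (j, N)) => j N.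
  exact: (selP (j, N)).
pose k := fix k j := if j is i.+1 then sel j (k i).+1 else sel 0%N 0%N.
exists k, u; split => //.
  apply: homo_ltn; first exact: ltn_trans.
  by move=> i /=; case: (selP i.+1 (k i).+1).
have kP j : {in l j, forall x, `|w (k j) x - u x| < j.+1%:R^-1}.
  by case: j => [|j] /=; [case: (selP 0%N 0%N)|case: (selP j.+1 (k j).+1)].
move=> x; apply/cvgrPdist_lt => e e0.
have e30 : 0 < e / 3 by rewrite divr_gt0.
have [d d0 dP] := hoelder_modulus s s0 C (e / 3) C0 e30.
have [r xr] : exists r, dist x (q r) < d.
  have d20 : 0 < d / 2 by rewrite divr_gt0.
  have near_rat (t : R) : exists q : rat, `|t - ratr q| < d / 2.
    have tr : t - d / 2 < t + d / 2 by rewrite ltrBlDr -addrA ltrDl addr_gt0.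
    have [p] := rat_in_itvoo tr.
    by rewrite in_itv/= => /andP[? ?]; exists p; rewrite ltr_norml; lra.
  have [r1 xr1] := near_rat x.1; have [r2 xr2] := near_rat x.2.
  exists (r1, r2); rewrite (splitr d).
  by apply: le_lt_trans (dist_le_normD _ _) _; rewrite ltrD.
near=> j.
have rl : q r \in l j.
  apply: map_f; rewrite mem_pmap; apply/mapP; exists (pickle r).
    by rewrite mem_iota add0n; near: j; exact: nbhs_infty_gt.
  by rewrite pickleK.
have je : j.+1%:R^-1 < e / 3.
  by near: j; exact: near_infty_natSinv_lt (PosNum e30).
have := le_lt_trans (hu x (q r) I I) (dP _ _ xr).
have := le_lt_trans (hw (k j) x (q r) I I) (dP _ _ xr).
have := lt_trans (kP j _ rl) je.
rewrite !ltr_norml; move: (w _ _) (w _ _) (u _) (u _) => *; lra.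
Unshelve. all: by end_near. Qed.

End selection.

(** * Clamping a competitor between the obstacles *)

Section clamp.
Context {R : realType}.
Implicit Types (x : R * R) (G : set (R * R)).

Definition clamp (a b w : R * R -> R) x := Num.max (a x) (Num.min (b x) (w x)).

Lemma clamp_obstacle_set (s C1 C2 : R) G (a b w : R * R -> R) :
  0 < s -> open G -> 0 <= C1 -> 0 <= C2 -> (forall x, G x -> a x <= b x) ->
  obstacle_set s C1 C2 G a b a -> obstacle_set s C1 C2 G a b b ->
  hoelder_on s C2 G w -> (forall x, G x -> `|w x| <= C1) ->
  obstacle_set s C1 C2 G a b (clamp a b w).
Proof.
move=> s0 oG C10 C20 ab.
move=> /(obstacle_setP s s0 _ _ _ _ _ _ oG C10 C20)[ha aC1 _].
move=> /(obstacle_setP s s0 _ _ _ _ _ _ oG C10 C20)[hb bC1 _] hw wC1.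
apply/(obstacle_setP s s0 _ _ _ _ _ _ oG C10 C20); split => [|x Gx|x Gx].
- by apply: hoelder_on_max => //; exact: hoelder_on_min.
- have ax := aC1 _ Gx; have bx := bC1 _ Gx; have wx := wC1 _ Gx.
  by rewrite /clamp maxEle minEle; case: ifP => // _; case: ifP.
- rewrite /clamp le_max lexx/= ge_max ab//=.
  by rewrite ge_min lexx.
Qed.

(** Where [w] violates one of the new obstacles [a'], [b'], it does so by at most
    the distance of that obstacle to the old one, as [w] respects [a] and [b]. *)
Lemma dist_clamp (a b w a' b' : R * R -> R) x : a x <= w x <= b x ->
  `|clamp a' b' w x - w x| <= `|a' x - a x| + `|b' x - b x|.
Proof.
move=> /andP[]; rewrite /clamp.
move: (a x) (b x) (w x) (a' x) (b' x) => ra rb rw ra' rb' aw wb.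
have a'a := ler_norm (ra' - ra); have a'a0 := normr_ge0 (ra' - ra).
have := ler_norm (rb - rb'); rewrite distrC => b'b.
have b'b0 := normr_ge0 (rb' - rb).
move: (`|ra' - ra|) (`|rb' - rb|) a'a a'a0 b'b b'b0 => A B a'a a'a0 b'b b'b0.
rewrite ler_norml.
by have [?|?] := leP rb' rw; [have [?|?] := leP ra' rb'|have [?|?] := leP ra' rw]; lra.
Qed.

Lemma cvg_clamp (a_ b_ : nat -> R * R -> R) (a b w : R * R -> R) x :
  a x <= w x <= b x -> a_ n x @[n --> \oo] --> a x ->
  b_ n x @[n --> \oo] --> b x ->
  clamp (a_ n) (b_ n) w x @[n --> \oo] --> w x.
Proof.
move=> awb /cvgrPdist_lt aP /cvgrPdist_lt bP; apply/cvgrPdist_lt => e e0.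
have e20 : 0 < e / 2 by rewrite divr_gt0.
near=> n; rewrite distrC; apply: le_lt_trans (dist_clamp _ _ _ _ _ _ awb) _.
rewrite (splitr e) ltrD// distrC; near: n; [exact: aP|exact: bP].
Unshelve. all: by end_near. Qed.

End clamp.

(** * Convergence of the extended maximizers *)

Lemma cvg_subsequence (k : nat -> nat) :
  {homo k : m n / (m < n)%N} -> k j @[j --> \oo] --> \oo.
Proof.
move=> hk; have kge j : (j <= k j)%N.
  by elim: j => // j IHj; apply: leq_ltn_trans IHj _; exact: hk.
by move=> P [N _ NP]; exists N => // j /= Nj; apply: NP; exact: leq_trans (kge j).
Qed.

Lemma cvg_uniform_at (T : choiceType) (R : realType) (A : set T)
    (f_ : nat -> T -> R) (f : T -> R) (x : T) :
  {uniform A, f_ @ \oo --> f} -> A x -> f_ n x @[n --> \oo] --> f x.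
Proof.
move=> uf Ax; have xA : [set x] `<=` A by move=> _ ->.
have := uniform_subset_cvg _ xA uf; rewrite uniform_set1; exact.
Qed.

Lemma bounded_set_dist (R : realType) (G : set (R * R)) : bounded_set G ->
  exists2 D : R, 0 <= D & forall x, G x -> dist x (0, 0) <= D.
Proof.
move=> [M [_ bM]]; pose N := `|M| + 1.
have N0 : 0 <= N by rewrite addr_ge0.
exists (N + N); first by rewrite addr_ge0.
move=> x Gx; have : `|x| <= N.
  by apply: bM => //; rewrite /N; apply: le_lt_trans (ler_norm M) _; rewrite ltrDl.
rewrite prod_normE ge_max => /andP[x1 x2].
by apply: le_trans (dist_le_normD _ _) _; rewrite /= !subr0 lerD.
Qed.

Theorem theorem3p4 (R : realType)
    (s p C1 C2 : R) (hs0 : 0 < s) (hs1 : s < 1)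
    (hsp : 2 < s * p) (hpp : s * p < p)
    (hC1 : 0 < C1) (hC2 : 0 < C2) (hC12 : C1 + C2 <= 1)
    (a b : R * R) (hab : a != b)
    (Omega : set (R * R)) (Omega_ : nat -> set (R * R))
    (hOmega : bounded_domain_with_boundary (koch_snowflake a b) Omega)
    (hOmega_ : forall n,
      bounded_domain_with_boundary (koch_polygon a b n) (Omega_ n))
    (hincr : forall m n : nat, (m <= n)%N -> Omega_ m `<=` Omega_ n)
    (hexh : \bigcup_n Omega_ n = Omega)
    (f : R * R -> R) (hf : (@leb2 R).-integrable Omega (EFin \o f))
    (phi1 phi2 : R * R -> R) (phi1_ phi2_ : nat -> R * R -> R)
    (hphi1 : (sobolev s p Omega `&` continuous_on_closure Omega) phi1)
    (hphi2 : (sobolev s p Omega `&` continuous_on_closure Omega) phi2)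
    (hphi1_ : forall n,
      (sobolev s p Omega `&` continuous_on_closure Omega) (phi1_ n))
    (hphi2_ : forall n,
      (sobolev s p Omega `&` continuous_on_closure Omega) (phi2_ n))
    (hphi : forall x, Omega x -> phi1 x <= phi2 x)
    (hphi_ : forall n x, Omega x -> phi1_ n x <= phi2_ n x)
    (hK1 : forall n,
      obstacle_set s C1 C2 (Omega_ n) (phi1_ n) (phi2_ n) (phi1_ n))
    (hK2 : forall n,
      obstacle_set s C1 C2 (Omega_ n) (phi1_ n) (phi2_ n) (phi2_ n))
    (hcvg1 : {uniform closure Omega, phi1_ @ \oo --> phi1})
    (hcvg2 : {uniform closure Omega, phi2_ @ \oo --> phi2})
    (u_ : nat -> R * R -> R)
    (hu_ : forall n, maximizer (Omega_ n) f
      (obstacle_set s C1 C2 (Omega_ n) (phi1_ n) (phi2_ n)) (u_ n)) :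
  exists (k : nat -> nat) (u : R * R -> R),
    [/\ {homo k : m n / (m < n)%N},
        weakstar_cvg s Omega
          (fun j => mcshane s C2 (Omega_ (k j)) (u_ (k j))) u &
        maximizer Omega f (obstacle_set s C1 C2 Omega phi1 phi2) u].
Proof.
have [C10 C20 s1] := And3 (ltW hC1) (ltW hC2) (ltW hs1).
have [oO _ /bounded_set_dist[D D0 OD] _] := hOmega.
have oO_ n : open (Omega_ n) by case: (hOmega_ n).
have sub n : Omega_ n `<=` Omega by rewrite -hexh; exact: bigcup_sup.
have mO := open_measurable_plane _ oO.
have mO_ n := open_measurable_plane _ (oO_ n).
have obsP G phi phi' v oG := obstacle_setP s hs0 C1 C2 G phi phi' v oG C10 C20.
have phi1P x : Omega x -> phi1_ n x @[n --> \oo] --> phi1 x.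
  by move=> /subset_closure Ox; exact: cvg_uniform_at hcvg1 _.
have phi2P x : Omega x -> phi2_ n x @[n --> \oo] --> phi2 x.
  by move=> /subset_closure Ox; exact: cvg_uniform_at hcvg2 _.
pose w n := mcshane s C2 (Omega_ n) (u_ n).
have uP n : [/\ hoelder_on s C2 (Omega_ n) (u_ n),
    forall x, Omega_ n x -> `|u_ n x| <= C1 &
    forall x, Omega_ n x -> phi1_ n x <= u_ n x <= phi2_ n x].
  by apply/obsP => //; case: (hu_ n).
have hw n : hoelder_on s C2 setT (w n).
  by apply: mcshane_hoelder => //; case: (uP n).
have wu n x : Omega_ n x -> w n x = u_ n x.
  by apply: mcshane_id => //; case: (uP n).
have wB n x : `|w n x| <= C1 + C2 * (dist x (0, 0) + D) `^ s.
  have [hu uC1 _] := uP n.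
  apply: mcshane_bounded => //; first by rewrite addr_ge0// dist_ge0.
  move=> y /(sub n) Oy; apply: le_trans (dist_triangle (0, 0) _ _) _.
  by rewrite lerD2l dist_sym; exact: OD.
pose M := C1 + C2 * (D + D) `^ s.
have wM n x : Omega x -> `|w n x| <= M.
  move=> Ox; apply: le_trans (wB n x) _.
  rewrite lerD2l ler_wpM2l// ge0_ler_powR ?nnegrE ?addr_ge0 ?dist_ge0//.
    exact: ltW.
  by rewrite lerD2r OD.
have [k [u [hk hu wku]]] := hoelder_selection s hs0 C2 w _ C20 hw wB.
have k_oo := cvg_subsequence k hk.
have mw n : measurable_fun setT (w n) by exact: hoelder_measurable hs0 C20 (hw n).
have exh x : Omega x -> \forall j \near \oo, Omega_ (k j) x.
  rewrite -hexh => -[m _ mx]; apply: (k_oo (fun n => Omega_ n x)).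
  by exists m => // n /= mn; exact: hincr mx.
have Ku : obstacle_set s C1 C2 Omega phi1 phi2 u.
  apply/obsP => //; split; first exact: hoelder_onS hu.
    move=> x Ox; apply: (ler_cvg_to (cvg_norm (wku x)) (cvg_cst C1)).
    near=> j; have jx : Omega_ (k j) x by near: j; exact: exh.
    by rewrite wu//; have [_ + _] := uP (k j); exact.
  move=> x Ox; apply/andP; split.
    apply: (ler_cvg_to (cvg_comp _ _ k_oo (phi1P x Ox)) (wku x)).
    near=> j; have jx : Omega_ (k j) x by near: j; exact: exh.
    by rewrite wu//; have [_ _ /(_ _ jx)/andP[]] := uP (k j).
  apply: (ler_cvg_to (wku x) (cvg_comp _ _ k_oo (phi2P x Ox))).
  near=> j; have jx : Omega_ (k j) x by near: j; exact: exh.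
  by rewrite wu//; have [_ _ /(_ _ jx)/andP[]] := uP (k j).
exists k, u; split => //.
  split => [j||g ig|h ih].
  - apply: (sobolev_inftyP s M C2) => //; first by move=> x; exact: wM.
    exact: hoelder_onS (hw _).
  - by case: Ku.
  - apply: (@cvg_Rintegral_exhaustion _ _ _ (@leb2 R) Omega (fun=> Omega)
      (fun j => w (k j)) u g M) => //.
    + by move=> j x.
    + by move=> x Ox; exact: nearW.
    + by move=> j; exact: measurable_funS (mw _).
    + by move=> j x; exact: wM.
  - apply: (@cvg_Rintegral_exhaustion _ _ _ (@leb4 R) (Omega `*` Omega)
      (fun=> Omega `*` Omega) (fun j => hoelder_quotient s (w (k j)))
      (hoelder_quotient s u) h C2) => //.
    + exact: measurableX.
    + by move=> _; exact: measurableX.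
    + by move=> j z.
    + by move=> z Oz; exact: nearW.
    + move=> j; apply: measurable_funS (measurable_hoelder_quotient _ _ (mw _)) => //.
    + move=> j z Oz; apply: (hoelder_quotient_bounded s C2 Omega) => //.
      exact: hoelder_onS (hw _).
    + by move=> z _; apply: cvgM; [apply: cvgB; exact: wku|exact: cvg_cst].
split => // v /(obsP _ _ _ _ oO)[hv vC1 vphi].
(* the competitor is only controlled on [Omega]; its extension is measurable *)
pose W := mcshane s C2 Omega v.
have Wv x : Omega x -> W x = v x by exact: mcshane_id.
have hW : hoelder_on s C2 setT W by exact: mcshane_hoelder.
have mW : measurable_fun setT W by exact: hoelder_measurable hs0 C20 hW.
pose v_ n := clamp (phi1_ n) (phi2_ n) W.
have Kv_ n : obstacle_set s C1 C2 (Omega_ n) (phi1_ n) (phi2_ n) (v_ n).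
  apply: clamp_obstacle_set => //.
  - by move=> x /(sub n); exact: hphi_.
  - exact: hoelder_onS hW.
  - by move=> x /(sub n) Ox; rewrite Wv//; exact: vC1.
have v_v x : Omega x -> v_ n x @[n --> \oo] --> v x.
  move=> Ox; rewrite -Wv//; apply: (cvg_clamp _ _ phi1 phi2).
  - by rewrite Wv// vphi.
  - exact: phi1P.
  - exact: phi2P.
have lhs : \int[@leb2 R]_(x in Omega_ (k j)) (v_ (k j) x * f x) @[j --> \oo]
    --> \int[@leb2 R]_(x in Omega) (v x * f x).
  apply: (@cvg_Rintegral_exhaustion _ _ _ (@leb2 R) Omega
    (fun j => Omega_ (k j)) (fun j => v_ (k j)) v f C1) => //.
  - by move=> j; exact: mO_.
  - move=> j; have [[mphi1 _] _] := hphi1_ (k j).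
    have [[mphi2 _] _] := hphi2_ (k j).
    exact: measurable_maxr mphi1
      (measurable_minr mphi2 (measurable_funS measurableT (@subsetT _ _) mW)).
  - by move=> j x jx; have /obsP[//|_ + _] := Kv_ (k j); exact.
  - by move=> x Ox; exact: cvg_comp k_oo (v_v x Ox).
have rhs : \int[@leb2 R]_(x in Omega_ (k j)) (w (k j) x * f x) @[j --> \oo]
    --> \int[@leb2 R]_(x in Omega) (u x * f x).
  apply: (@cvg_Rintegral_exhaustion _ _ _ (@leb2 R) Omega
    (fun j => Omega_ (k j)) (fun j => w (k j)) u f M) => //.
  - by move=> j; exact: mO_.
  - by move=> j; exact: measurable_funS (mw _).
  - by move=> j x /(sub (k j)); exact: wM.
apply: ler_cvg_to lhs rhs _; apply: nearW => j.
rewrite [leRHS](_ : _ = \int[@leb2 R]_(x in Omega_ (k j)) (u_ (k j) x * f x)).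
  by have [_] := hu_ (k j); apply.
by apply: eq_Rintegral => x /set_mem jx; rewrite wu.
Unshelve. all: by end_near. Qed.
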